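(* For every composition $\alpha$ of $n$, $$\mathcal{HQ}_\alpha(X;Y)=\sum_{T\in SHCT(\alpha)}\tilde Q_{n,D(T)}(X;Y).$$
   Context: Fix $k,l\ge0$, $\mathcal{A}=\{1,\dots,k\}$, $\mathcal{A}'=\{1',\dots,l'\}$ with total order $1<\dots<k<1'<\dots<l'$, $X=(x_1,\dots,x_k)$, $Y=(y_1,\dots,y_l)$. French notation: row $i$ is the $i$-th from the bottom; cell $(i,j)$ is row $i$, column $j$. For a composition $\alpha=(\alpha_1,\dots,\alpha_r)$ with largest part $m$ the diagram has $\alpha_i$ cells in row $i$; for a filling $F$, $\hat F$ denotes the $r\times m$ array with $\infty$ (larger than all entries, in neither alphabet) in the missing cells. A hook composition tableau (HCT) of shape $\alpha$ is a filling $F$ with letters of $\mathcal{A}\cup\mathcal{A}'$ such that: rows weakly increase left to right; unprimed entries weakly and primed entries strictly increase along rows; in the leftmost column unprimed entries strictly and primed entries weakly increase bottom to top; and for all $1\le i<j\le r$, $1\le n<m$: (a) if $\hat F(i,n+1)\in\mathcal{A}$ and $\hat F(i,n+1)\ge\hat F(j,n)$ then $\hat F(i,n+1)>\hat F(j,n+1)$; (b) if $\hat F(i,n+1)\in\mathcal{A}'$ and $\hat F(i,n+1)>\hat F(j,n)$ then $\hat F(i,n+1)\ge\hat F(j,n+1)$. $\mathcal{HQ}_\alpha(X;Y)=\sum_F\prod_ix_i^{v_i}\prod_iy_i^{u_i}$ over HCT $F$ of shape $\alpha$, where $v_i,u_i$ count entries $i$, $i'$. A standard hook composition tableau of shape $\alpha\vDash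 n$ is a filling of the diagram of $\alpha$ with $1,\dots,n$, each used once, such that rows increase left to right, the leftmost column increases bottom to top, and for all $1\le i<j\le r$, $1\le n'<m$: if $\hat F(i,n'+1)\ne\infty$ and $\hat F(i,n'+1)>\hat F(j,n')$ then $\hat F(i,n'+1)>\hat F(j,n'+1)$. $SHCT(\alpha)$ is the set of these. The descent set of such $T$ is $D(T)=\{i\in[n-1]: i+1 \text{ lies in a column weakly left of the column of } i\}$. With $z_a=x_a$ ($a\in\mathcal{A}$), $z_{a'}=y_a$ ($a'\in\mathcal{A}'$), for $D\subseteq[n-1]$ let $\tilde Q_{n,D}(X;Y)=\sum z_{a_1}\cdots z_{a_n}$ over $a_1\le\dots\le a_n$ in $\mathcal{A}\cup\mathcal{A}'$ with $a_i=a_{i+1}\in\mathcal{A}\Rightarrow i\notin D$ and $a_i=a_{i+1}\in\mathcal{A}'\Rightarrow i\in D$. *)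

(* Defs.v *)
From mathcomp Require Import all_boot all_order all_algebra.
From mathcomp Require Import mpoly.

Set Implicit Arguments.
Unset Strict Implicit.
Unset Printing Implicit Defensive.

Import GRing.Theory.

(* Rows, columns and entries are numbered from 0; row 0 is the bottom row. *)

Definition is_composition (n : nat) (al : seq nat) : bool :=
  all (fun p => 0 < p) al && (sumn al == n).

Definition width (al : seq nat) : nat := \max_(p <- al) p.

Definition cell (al : seq nat) : finType :=
  {c : 'I_(size al) * 'I_(width al) | c.2 < nth 0 al c.1}.

Definition row_of (al : seq nat) (c : cell al) : 'I_(size al) := (val c).1.
Definition col_of (al : seq nat) (c : cell al) : 'I_(width al) := (val c).2.

Definition filling (N : nat) (al : seq nat) : finType :=
  {ffun cell al -> 'I_N}.

(* The array F^, where None stands for infinity. *)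
Definition hat (N : nat) (al : seq nat) (F : filling N al)
    (i : 'I_(size al)) (j : 'I_(width al)) : option nat :=
  if insub (i, j) is Some c then Some (F c : nat) else None.

Definition le_inf (a b : option nat) : bool :=
  match a, b with
  | _, None => true
  | None, Some _ => false
  | Some x, Some y => x <= y
  end.

Definition lt_inf (a b : option nat) : bool :=
  match a, b with
  | None, _ => false
  | Some _, None => true
  | Some x, Some y => x < y
  end.

(* The totally ordered alphabet 1 < ... < k < 1' < ... < l' is 'I_(k + l):
   lshift l i is the unprimed letter i + 1, and rshift k j is the primed
   letter (j + 1)'. *)
Definition unprimed (k : nat) (a : nat) : bool := a < k.
Definition primed (k : nat) (a : nat) : bool := k <= a.

Definition hat_unprimed (k : nat) (a : option nat) : bool :=
  if a is Some x then unprimed k x else false.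
Definition hat_primed (k : nat) (a : option nat) : bool :=
  if a is Some x then primed k x else false.

Definition HCT_rows (k l : nat) (al : seq nat) (F : filling (k + l) al) : bool :=
  [forall c : cell al, forall d : cell al,
    (row_of c == row_of d) && (col_of c < col_of d) ==>
    (F c <= F d) && (primed k (F c) && primed k (F d) ==> (F c < F d))].

Definition HCT_first_column (k l : nat) (al : seq nat) (F : filling (k + l) al) :
    bool :=
  [forall c : cell al, forall d : cell al,
    [&& col_of c == 0 :> nat, col_of d == 0 :> nat & row_of c < row_of d] ==>
    (F c <= F d) && (unprimed k (F c) && unprimed k (F d) ==> (F c < F d))].

Definition HCT_triples (k l : nat) (al : seq nat) (F : filling (k + l) al) : bool :=
  [forall i : 'I_(size al), forall j : 'I_(size al),
   forall p : 'I_(width al), forall q : 'I_(width al),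
    (i < j) && (q == p.+1 :> nat) ==>
    (hat_unprimed k (hat F i q) && le_inf (hat F j p) (hat F i q) ==>
       lt_inf (hat F j q) (hat F i q)) &&
    (hat_primed k (hat F i q) && lt_inf (hat F j p) (hat F i q) ==>
       le_inf (hat F j q) (hat F i q))].

Definition is_HCT (k l : nat) (al : seq nat) (F : filling (k + l) al) : bool :=
  [&& HCT_rows F, HCT_first_column F & HCT_triples F].

Definition multiplicity (N : nat) (al : seq nat) (F : filling N al) (a : 'I_N) : nat :=
  #|[set c | F c == a]|.

Section Polynomials.
Local Open Scope ring_scope.

(* The variables (X; Y) are indexed by the alphabet. *)
Definition xvar (k l : nat) (i : 'I_k) : {mpoly int[k + l]} := 'X_(lshift l i).
Definition yvar (k l : nat) (j : 'I_l) : {mpoly int[k + l]} := 'X_(rshift k j).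

Definition zvar (k l : nat) (a : 'I_(k + l)) : {mpoly int[k + l]} :=
  match split a with
  | inl i => xvar l i
  | inr j => yvar k j
  end.

Definition HQ (k l : nat) (al : seq nat) : {mpoly int[k + l]} :=
  \sum_(F : filling (k + l) al | is_HCT F)
    (\prod_(i < k) xvar l i ^+ multiplicity F (lshift l i)) *
    (\prod_(j < l) yvar k j ^+ multiplicity F (rshift k j)).

(* An element i of D : {set 'I_n.-1} stands for the element i + 1 of [n - 1]:
   it concerns the terms of a at the 0-based positions i and i + 1. *)
Definition Qtilde_admissible (k l n : nat) (D : {set 'I_n.-1})
    (a : {ffun 'I_n -> 'I_(k + l)}) : bool :=
  [forall p : 'I_n, forall q : 'I_n, (p <= q)%N ==> (a p <= a q)%N] &&
  [forall i : 'I_n.-1, forall p : 'I_n, forall q : 'I_n,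
    [&& p == i :> nat, q == i.+1 :> nat & a p == a q] ==>
    (unprimed k (a p) ==> (i \notin D)) && (primed k (a p) ==> (i \in D))].

Definition Qtilde (k l n : nat) (D : {set 'I_n.-1}) : {mpoly int[k + l]} :=
  \sum_(a : {ffun 'I_n -> 'I_(k + l)} | Qtilde_admissible D a)
    \prod_(p < n) zvar (a p).

End Polynomials.

(* The entries 1, ..., n of a standard tableau are shifted to 0, ..., n - 1. *)
Definition each_used_once (n : nat) (al : seq nat) (T : filling n al) : bool :=
  [forall v : 'I_n, multiplicity T v == 1].

Definition SHCT_rows (n : nat) (al : seq nat) (T : filling n al) : bool :=
  [forall c : cell al, forall d : cell al,
    (row_of c == row_of d) && (col_of c < col_of d) ==> (T c < T d)].

Definition SHCT_first_column (n : nat) (al : seq nat) (T : filling n al) : bool :=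
  [forall c : cell al, forall d : cell al,
    [&& col_of c == 0 :> nat, col_of d == 0 :> nat & row_of c < row_of d] ==>
    (T c < T d)].

Definition SHCT_triples (n : nat) (al : seq nat) (T : filling n al) : bool :=
  [forall i : 'I_(size al), forall j : 'I_(size al),
   forall p : 'I_(width al), forall q : 'I_(width al),
    (i < j) && (q == p.+1 :> nat) ==>
    ((hat T i q != None) && lt_inf (hat T j p) (hat T i q) ==>
       lt_inf (hat T j q) (hat T i q))].

Definition is_SHCT (n : nat) (al : seq nat) (T : filling n al) : bool :=
  [&& each_used_once T, SHCT_rows T, SHCT_first_column T & SHCT_triples T].

Definition descent_set (n : nat) (al : seq nat) (T : filling n al) :
    {set 'I_n.-1} :=
  [set i : 'I_n.-1 | [exists c : cell al, exists d : cell al,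
    [&& T c == i :> nat, T d == i.+1 :> nat & col_of d <= col_of c]]].

(* Main.v *)
(** Sending a pair (T, a), with a admissible for D(T), to the filling a o T is a
    bijection onto the hook composition tableaux, and it preserves weights. The
    inverse is standardization: the letters of F are read in increasing order,
    equal unprimed letters from left to right, and equal primed letters from
    right to left, where within a column they are read bottom to top in the
    leftmost column and top to bottom in the others. *)

Require Import Defs.
From mathcomp Require Import all_boot all_order all_algebra.
From mathcomp Require Import mpoly.
From mathcomp Require Import zify.

Set Implicit Arguments.
Unset Strict Implicit.
Unset Printing Implicit Defensive.

Import GRing.Theory.

(** * Cells of the diagram, tableau conditions in terms of cells, and weights *)

Lemma card_cell (al : seq nat) : #|cell al| = sumn al.
Proof.
rewrite card_sig -sum1_card.
rewrite (eq_bigl (fun c : 'I_(size al) * 'I_(width al) =>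
  true && (c.2 < nth 0 al c.1))) //.
rewrite -(pair_big_dep predT
  (fun (i : 'I_(size al)) (j : 'I_(width al)) => j < nth 0 al i)
  (fun _ _ => 1)) /=.
rewrite sumnE (big_nth 0) big_mkord; apply: eq_bigr => i _.
(* No part exceeds [width al], so the bound on columns truncates no row. *)
rewrite -(big_ord_widen (width al) (fun=> 1)) ?sum1_card ?card_ord //.
by apply: (@leq_bigmax_seq _ al predT id); rewrite ?mem_nth.
Qed.

Lemma cell_inj (al : seq nat) (c d : cell al) :
  row_of c = row_of d :> nat -> col_of c = col_of d :> nat -> c = d.
Proof.
move=> /val_inj er /val_inj ec; apply: val_inj.
rewrite (surjective_pairing (val c)) (surjective_pairing (val d)).
by rewrite -[(val c).1]/(row_of c) -[(val c).2]/(col_of c) er ec.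
Qed.

Lemma left_cell (al : seq nat) (c : cell al) :
  0 < col_of c -> exists2 d : cell al,
    row_of d = row_of c & (col_of d).+1 = col_of c :> nat.
Proof.
move=> c_gt0; have lt_w: (col_of c).-1 < width al.
  by rewrite (leq_ltn_trans (leq_pred _)).
have lt_al: Ordinal lt_w < nth 0 al (row_of c).
  by rewrite (leq_ltn_trans (leq_pred _)) // (valP c).
exists (Sub (row_of c, Ordinal lt_w) lt_al); first by rewrite /row_of SubK.
by rewrite {1}/col_of SubK /= prednK.
Qed.

Lemma hat_cell (N : nat) (al : seq nat) (F : filling N al) (c : cell al) :
  hat F (row_of c) (col_of c) = Some (F c : nat).
Proof.
rewrite /hat.
by have -> : (row_of c, col_of c) = val c; [case: c => [[]] | rewrite valK].
Qed.

Variant hat_spec (N : nat) (al : seq nat) (F : filling N al) i j :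
    option nat -> Prop :=
  | HatSome c of row_of c = i & col_of c = j : hat_spec F i j (Some (F c : nat))
  | HatNone : hat_spec F i j None.

Lemma hatP (N : nat) (al : seq nat) (F : filling N al) i j :
  hat_spec F i j (hat F i j).
Proof.
rewrite /hat; case: insubP => [c _ ec | _]; last exact: HatNone.
by constructor; rewrite /row_of /col_of ec.
Qed.

(** Infinite entries disappear here: nothing exceeds an infinite entry left of [e], so the premise
    supplies the cell [d], and an infinite entry in place of [e] would violate the conclusion, so
    [e] must exist. *)
Lemma SHCT_triplesP (n : nat) (al : seq nat) (T : filling n al) :
  reflect
    (forall c d : cell al, row_of c < row_of d ->
       col_of c = (col_of d).+1 :> nat -> T d < T c ->
       exists e : cell al,
         [/\ row_of e = row_of d, col_of e = col_of c & T e < T c])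
    (SHCT_triples T).
Proof.
apply: (iffP idP) => [tri c d lt_r eq_c lt_T | tri].
  move/forallP/(_ (row_of c))/forallP/(_ (row_of d))/forallP/(_ (col_of d)): tri.
  move/forallP/(_ (col_of c)); rewrite lt_r eq_c eqxx /=.
  rewrite (hat_cell T c) (hat_cell T d) /= lt_T /=.
  by case: hatP => //= e er ec ltT; exists e.
apply/forallP=> i; apply/forallP=> j; apply/forallP=> p; apply/forallP=> q.
apply/implyP=> /andP[lt_ij /eqP eq_q]; case: (hatP T i q) => //= c ri cq.
case: (hatP T j p) => //= d rj cp; apply/implyP=> ltT.
have [||e [re ce ltTe]] := tri c d _ _ ltT; rewrite ?ri ?rj ?cq ?cp //.
by rewrite -rj -re -cq -ce hat_cell.
Qed.

Lemma HCT_triplesP (k l : nat) (al : seq nat) (F : filling (k + l) al) :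
  reflect
    (forall c d : cell al, row_of c < row_of d ->
       col_of c = (col_of d).+1 :> nat ->
       if F c < k then F d <= F c ->
         exists e : cell al,
           [/\ row_of e = row_of d, col_of e = col_of c & F e < F c]
       else F d < F c ->
         exists e : cell al,
           [/\ row_of e = row_of d, col_of e = col_of c & F e <= F c])
    (HCT_triples F).
Proof.
apply: (iffP idP) => [tri c d lt_r eq_c | tri].
  move/forallP/(_ (row_of c))/forallP/(_ (row_of d))/forallP/(_ (col_of d)): tri.
  move/forallP/(_ (col_of c)); rewrite lt_r eq_c eqxx /=.
  rewrite (hat_cell F c) (hat_cell F d) /= /unprimed /primed.
  case: ltnP => _ /=; rewrite ?andbT => /implyP tri /tri {tri}.
    by case: hatP => //= e er ec ltT; exists e.
  by case: hatP => //= e er ec ltT; exists e.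
apply/forallP=> i; apply/forallP=> j; apply/forallP=> p; apply/forallP=> q.
apply/implyP=> /andP[lt_ij /eqP eq_q]; case: (hatP F i q) => //= c ri cq.
case: (hatP F j p) => [d rj cp |] /=; last by rewrite !andbF.
rewrite /unprimed /primed.
have := tri c d; rewrite ri rj cq cp => /(_ lt_ij eq_q).
case: ltnP => _ /=; rewrite ?andbT => {}tri; apply/implyP=> /tri[e [re ce]].
  by rewrite -re -ce hat_cell.
by rewrite -re -ce hat_cell.
Qed.

Lemma SHCT_rowsP (n : nat) (al : seq nat) (T : filling n al) :
  reflect (forall c d : cell al, row_of c = row_of d -> col_of c < col_of d ->
             T c < T d)
          (SHCT_rows T).
Proof.
apply: (iffP idP) => [rows c d er lt_c | rows].
  move/forallP/(_ c)/forallP/(_ d)/implyP: rows; apply.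
  by rewrite er eqxx.
apply/forallP=> c; apply/forallP=> d; apply/implyP=> /andP[/eqP er lt_c].
exact: rows.
Qed.

Lemma SHCT_first_columnP (n : nat) (al : seq nat) (T : filling n al) :
  reflect (forall c d : cell al, col_of c = 0 :> nat -> col_of d = 0 :> nat ->
             row_of c < row_of d -> T c < T d)
          (SHCT_first_column T).
Proof.
apply: (iffP idP) => [fcol c d c0 d0 lt_r | fcol].
  by move/forallP/(_ c)/forallP/(_ d)/implyP: fcol; apply; rewrite c0 d0.
apply/forallP=> c; apply/forallP=> d; apply/implyP.
by case/and3P=> /eqP c0 /eqP d0; apply: fcol.
Qed.

(** The alphabet of the smaller letter decides alone: above a primed letter all letters are primed,
    and an unprimed letter is strictly below every primed one. The same remark yields the form used
    for the first column. *)
Lemma HCT_rowsP (k l : nat) (al : seq nat) (F : filling (k + l) al) :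
  reflect (forall c d : cell al, row_of c = row_of d -> col_of c < col_of d ->
             if F c < k then F c <= F d else F c < F d)
          (HCT_rows F).
Proof.
apply: (iffP idP) => [rows c d er lt_c | rows].
  move/forallP/(_ c)/forallP/(_ d)/implyP: rows; rewrite er eqxx lt_c.
  by rewrite /primed; case: ifP; lia.
apply/forallP=> c; apply/forallP=> d; apply/implyP=> /andP[/eqP er lt_c].
by have := rows c d er lt_c; rewrite /primed; case: ifP; lia.
Qed.

Lemma HCT_first_columnP (k l : nat) (al : seq nat) (F : filling (k + l) al) :
  reflect (forall c d : cell al, col_of c = 0 :> nat -> col_of d = 0 :> nat ->
             row_of c < row_of d -> if F c < k then F c < F d else F c <= F d)
          (HCT_first_column F).
Proof.
apply: (iffP idP) => [fcol c d c0 d0 lt_r | fcol].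
  move/forallP/(_ c)/forallP/(_ d)/implyP: fcol; rewrite c0 d0 lt_r.
  by rewrite /unprimed; case: ifP; lia.
apply/forallP=> c; apply/forallP=> d; apply/implyP.
case/and3P=> /eqP c0 /eqP d0 lt_r.
by have := fcol c d c0 d0 lt_r; rewrite /unprimed; case: ifP; lia.
Qed.

Lemma HCT_weight (k l : nat) (al : seq nat) (F : filling (k + l) al) :
  ((\prod_(i < k) xvar l i ^+ multiplicity F (lshift l i)) *
   (\prod_(j < l) yvar k j ^+ multiplicity F (rshift k j)) =
   \prod_(c : cell al) zvar (F c))%R.
Proof.
rewrite (partition_big F predT) //= big_split_ord /=.
have prodE a : (\prod_(c | F c == a) zvar (F c) =
                zvar a ^+ multiplicity F a :> {mpoly int[k + l]})%R.
  rewrite (eq_bigr (fun=> zvar a)) => [|c /eqP-> //].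
  by rewrite prodr_const /multiplicity cardsE.
congr (_ * _)%R; apply: eq_bigr => i _; rewrite prodE /zvar.
  by rewrite (unsplitK (inl i)).
by rewrite (unsplitK (inr i)).
Qed.

(** * The reading order and standardization by rank *)

(* The order in which standardization reads the cells of [F]. Comparing rows
   when two equal unprimed letters share a column only serves to make the order
   total on arbitrary fillings: this never happens in a tableau. *)
Definition precedes (k N : nat) (al : seq nat) (F : filling N al) : rel (cell al) :=
  fun c d =>
    (F c < F d) || (F c == F d :> nat) &&
      (if F c < k then
         (col_of c < col_of d) ||
         (col_of c == col_of d :> nat) && (row_of c < row_of d)
       else
         (col_of d < col_of c) ||
         (col_of c == col_of d :> nat) &&
           (if col_of c == 0 :> nat then row_of c < row_of d
            else row_of d < row_of c)).

Lemma precedes_irr k N al (F : filling N al) : irreflexive (precedes k F).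
Proof. by move=> c; rewrite /precedes !ltnn !eqxx /= !if_same. Qed.

Lemma precedes_trans k N al (F : filling N al) : transitive (precedes k F).
Proof.
move=> d c e; rewrite /precedes.
by repeat case: ifP => ?; lia.
Qed.

Lemma precedes_total k N al (F : filling N al) (c d : cell al) :
  c != d -> precedes k F c d || precedes k F d c.
Proof.
move=> neq; rewrite /precedes.
have : (row_of c == row_of d :> nat) && (col_of c == col_of d :> nat) = false.
  by apply/negP=> /andP[/eqP er /eqP ec]; rewrite (cell_inj er ec) eqxx in neq.
by repeat case: ifP => ?; lia.
Qed.

Lemma card_before_lt (T : finType) (R : rel T) (c d : T) :
  irreflexive R -> transitive R -> R c d ->
  #|[set e | R e c]| < #|[set e | R e d]|.
Proof.
move=> irr trans Rcd; apply/proper_card/properP; split.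
  by apply/subsetP=> e; rewrite !inE => /trans/(_ Rcd).
by exists c; rewrite inE ?irr.
Qed.

Lemma each_used_once_bij (n : nat) (al : seq nat) (T : filling n al) :
  each_used_once T -> bijective T.
Proof.
move=> /forallP once.
have oneT p : exists c, [set c | T c == p] == [set c].
  by have /cards1P[c ->] := once p; exists c.
pose g p := xchoose (oneT p).
have gE p : [set c | T c == p] = [set g p] by exact/eqP/(xchooseP (oneT p)).
exists g => [c | p].
  by have /set1P/esym : c \in [set g (T c)] by rewrite -gE inE.
by have := set11 (g p); rewrite -gE inE => /eqP.
Qed.

Lemma bij_each_used_once (n : nat) (al : seq nat) (T : filling n al) :
  bijective T -> each_used_once T.
Proof.
case=> g TK gK; apply/forallP=> p; apply/cards1P; exists (g p).
by apply/setP=> c; rewrite !inE (can2_eq TK gK).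
Qed.

Lemma card_below (T : finType) (n : nat) (f : T -> 'I_n) (c : T) :
  bijective f -> #|[set d | f d < f c]| = f c.
Proof.
case=> g fK gK; rewrite cardsE -sum1_card (reindex g) /=; last first.
  by exists f => ? _; rewrite ?fK ?gK.
rewrite (eq_bigl (fun p : 'I_n => p < f c)) => [|p]; last by rewrite unfold_in gK.
by rewrite -(big_ord_widen n (fun=> 1)) ?sum1_card ?card_ord // ltnW.
Qed.

(** A bijection onto ['I_n] is recovered from the order it induces, since its value at [c] counts
    the elements below [c]. This makes the standard tableau unique once its order is known. *)
Lemma bij_same_order (T : finType) (n : nat) (f g : T -> 'I_n) :
  bijective f -> bijective g -> (forall c d, (f c < f d) = (g c < g d)) ->
  f =1 g.
Proof.
move=> f_bij g_bij same c; apply: val_inj => /=.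
rewrite -(card_below c f_bij) -(card_below c g_bij).
by apply: eq_card => d; rewrite !inE same.
Qed.

(** The entry of a cell is the number of cells that precede it. Totality of the order makes this
    rank injective, hence bijective by cardinality. *)
Lemma standardization_exists (k n N : nat) (al : seq nat) (F : filling N al) :
  #|cell al| = n ->
  exists2 T : filling n al,
    bijective T & forall c d, (T c < T d) = precedes k F c d.
Proof.
move=> <-; have rank_lt c : #|[set e | precedes k F e c]| < #|cell al|.
  rewrite -cardsT; apply/proper_card/properP; split; first exact: subsetT.
  by exists c; rewrite !inE ?precedes_irr.
pose T : filling #|cell al| al := [ffun c => Ordinal (rank_lt c)].
have lt_prec c d : precedes k F c d -> T c < T d.
  rewrite !ffunE /= => prec_cd.
  exact: card_before_lt (@precedes_irr k N al F) (@precedes_trans k N al F) _.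
have TE c d : (T c < T d) = precedes k F c d.
  apply/idP/idP => [lt_T | /lt_prec //].
  have [eq_cd | /(precedes_total k F)/orP[// | /lt_prec]] := eqVneq c d.
    by rewrite eq_cd ltnn in lt_T.
  by rewrite ltnNge ltnW.
exists T => //; apply: inj_card_bij; last by rewrite card_ord.
move=> c d eq_T; apply/eqP/negPn/negP.
by move=> /(precedes_total k F)/orP[] /lt_prec; rewrite eq_T ltnn.
Qed.

(** * Admissible sequences and descents *)

Lemma Qtilde_admissibleP (k l n : nat) (al : seq nat) (T : filling n al)
    (a : {ffun 'I_n -> 'I_(k + l)}) :
  bijective T ->
  reflect
    ((forall c d, T c <= T d -> a (T c) <= a (T d)) /\
     (forall c d, T d = (T c).+1 :> nat -> a (T c) = a (T d) ->
        if a (T c) < k then col_of c < col_of d else col_of d <= col_of c))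
    (Qtilde_admissible (descent_set T) a).
Proof.
move=> T_bij; have T_inj := bij_inj T_bij.
(* Injectivity of [T] makes the two cells in the definition of a descent unique, so membership is a
   mere comparison of columns. *)
have descE (i : 'I_n.-1) c d : T c = i :> nat -> T d = i.+1 :> nat ->
    (i \in descent_set T) = (col_of d <= col_of c).
  move=> eq_c eq_d; rewrite inE; apply/existsP/idP => [[c' /existsP[d']] | le_cd].
    case/and3P=> /eqP eq_c' /eqP eq_d'.
    have -> : c' = c by apply/T_inj/val_inj; rewrite /= eq_c' eq_c.
    by have -> : d' = d by apply/T_inj/val_inj; rewrite /= eq_d' eq_d.
  by exists c; apply/existsP; exists d; rewrite eq_c eq_d !eqxx.
apply: (iffP andP) => [[/forallP mono /forallP adj] | [mono adj]].
  split=> [c d | c d eq_d eq_a].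
    by move/(_ (T c))/forallP/(_ (T d))/implyP: mono; exact.
  have lt_c : T c < n.-1 by have := ltn_ord (T d); lia.
  move/(_ (Ordinal lt_c))/forallP/(_ (T c))/forallP/(_ (T d)): adj.
  rewrite eq_d eq_a !eqxx /= (descE _ c d) // /unprimed /primed.
  by case: ltnP => _ /=; rewrite ?andbT // -ltnNge.
case: (T_bij) => g TK gK; split.
  apply/forallP=> p; apply/forallP=> q; apply/implyP.
  by rewrite -(gK p) -(gK q); apply: mono.
apply/forallP=> i; apply/forallP=> p; apply/forallP=> q; apply/implyP.
case/and3P=> /eqP eq_p /eqP eq_q /eqP eq_a.
have := adj (g p) (g q); rewrite !gK eq_q -{1}eq_p => /(_ erefl eq_a).
rewrite (descE i (g p) (g q)) ?gK // /unprimed /primed.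
by case: ltnP => _ /=; rewrite ?andbT // ltnNge.
Qed.

(** Monotonicity forces [a] to be constant between [T c] and [T d], so the column comparisons for
    consecutive entries chain by transitivity. The induction moves from [c] to the cell [e] with the
    next entry. *)
Lemma admissible_cols (k l n : nat) (al : seq nat) (T : filling n al)
    (a : {ffun 'I_n -> 'I_(k + l)}) (c d : cell al) :
  bijective T -> Qtilde_admissible (descent_set T) a ->
  T c < T d -> a (T c) = a (T d) ->
  if a (T c) < k then col_of c < col_of d else col_of d <= col_of c.
Proof.
move=> T_bij /(Qtilde_admissibleP _ T_bij)[mono adj].
have [m] := ubnP (T d - T c); elim: m c => // m IHm c lt_m lt_T eq_a.
have [eq_d | neq_d] := eqVneq (T d : nat) (T c).+1; first exact: adj.
have lt_d : (T c).+1 < T d by rewrite ltn_neqAle eq_sym neq_d.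
have [g _ gK] := T_bij; pose e := g (Ordinal (ltn_trans lt_d (ltn_ord (T d)))).
have eE : T e = (T c).+1 :> nat by rewrite gK.
have eq_e : a (T c) = a (T e).
  apply/val_inj/anti_leq; rewrite mono ?eE //= eq_a mono // eE ltnW //.
have := adj c e eE eq_e; have := IHm e; rewrite -eq_e eq_a eE lt_d.
by case: ifP => _ IH; have := IH _ isT erefl; lia.
Qed.

(** * From a standard tableau and an admissible sequence to a hook tableau *)

Section Destandardization.

Variables (k l n : nat) (al : seq nat) (T : filling n al).
Variable a : {ffun 'I_n -> 'I_(k + l)}.
Hypotheses (T_SHCT : is_SHCT T) (a_adm : Qtilde_admissible (descent_set T) a).

Let F : filling (k + l) al := [ffun c => a (T c)].

Let T_bij : bijective T.
Proof. by case/and4P: T_SHCT => /each_used_once_bij. Qed.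

Let F_mono c d : T c <= T d -> F c <= F d.
Proof. by rewrite !ffunE; case/(Qtilde_admissibleP _ T_bij): a_adm => + _; apply. Qed.

Let F_cols c d : T c < T d -> F c = F d :> nat ->
  if F c < k then col_of c < col_of d else col_of d <= col_of c.
Proof. by rewrite !ffunE => lt_T /val_inj; exact: admissible_cols. Qed.

Let F_rows : forall c d, row_of c = row_of d -> col_of c < col_of d ->
  if F c < k then F c <= F d else F c < F d.
Proof.
case/and4P: T_SHCT => _ /SHCT_rowsP rows _ _ c d er lt_c.
have lt_T := rows c d er lt_c; have le_F := F_mono (ltnW lt_T).
by have := F_cols lt_T; case: ifP => _; lia.
Qed.

Lemma destandardization_HCT : is_HCT F.
Proof.
case/and4P: T_SHCT => _ _ /SHCT_first_columnP fcol /SHCT_triplesP tri.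
apply/and3P; split; first exact/HCT_rowsP.
  apply/HCT_first_columnP => c d c0 d0 lt_r.
  have lt_T := fcol c d c0 d0 lt_r; have le_F := F_mono (ltnW lt_T).
  by have := F_cols lt_T; case: ifP => _; lia.
apply/HCT_triplesP => c d lt_r eq_c.
have neq_T : T c <> T d :> nat.
  by move/val_inj/(bij_inj T_bij) => eq_cd; rewrite eq_cd ltnn in lt_r.
(* If [T c < T d], the premise of the triple condition fails: [F c <= F d], and equality of unprimed
   letters is excluded because [c] lies to the right of [d]. *)
have [lt_T | ge_T] := ltnP (T d) (T c); last first.
  have lt_T : T c < T d by lia.
  by have := F_mono (ltnW lt_T); have := F_cols lt_T; case: ifP => _; lia.
have [e [re ce lt_e]] := tri c d lt_r eq_c lt_T.
(* [e] and [c] share a column, so [F_cols] forbids equality for unprimed letters and allows it for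
   primed ones, exactly as (a) and (b) require. *)
have le_F := F_mono (ltnW lt_e); have := F_cols lt_e; rewrite ce.
by case: (ltnP (F c) k) => lt_k eqF _; exists e; split => //; case: ifP eqF; lia.
Qed.

(** Since the right-hand side depends on [F] only, [T] can be recovered from [F]. The delicate case
    is that of equal primed letters in one column. *)
Lemma destandardization_order c d : (T c < T d) = precedes k F c d.
Proof.
have lt_prec c' d' : T c' < T d' -> precedes k F c' d'.
  move=> {c d} lt_T; rename c' into c, d' into d.
  have le_F := F_mono (ltnW lt_T); have cols := F_cols lt_T; rewrite /precedes.
  have [//| lt_F | eq_F] := ltngtP (F c) (F d).
    by rewrite leqNgt lt_F in le_F.
  move: (cols eq_F) => /=; case: ifP => [_ -> // | k_le].
  rewrite leq_eqVlt => /orP[/eqP|->//].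
  move=> eq_c; rewrite eq_c ltnn eqxx /=; case/and4P: T_SHCT => _ _ fcol tri.
  have neq_r : row_of c <> row_of d :> nat.
    by move/cell_inj/(_ (esym eq_c)) => eq_cd; rewrite eq_cd ltnn in lt_T.
  case: (posnP (col_of c)) => [c0 | c_gt0].
    rewrite ltnNge leq_eqVlt; apply/norP; split; first by apply/eqP; lia.
    apply/negP => /(SHCT_first_columnP _ fcol); rewrite eq_c c0.
    by move=> /(_ erefl erefl); lia.
  rewrite ltnNge leq_eqVlt; apply/norP; split; first by apply/eqP.
  (* Suppose [c] is below [d], and let [e] be the left neighbour of [d]. If [T e < T c], the triple
     condition would give [T d < T c]. Hence [T c <= T e], so [F e] is primed and
     [F c <= F e < F d], contradicting [F c = F d]. *)
  apply/negP => lt_r; have [|e re ce] := @left_cell _ d; first by rewrite eq_c.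
  have le_T : T c <= T e.
    rewrite leqNgt; apply/negP.
    move=> /(SHCT_triplesP _ tri); rewrite re ce eq_c => /(_ lt_r erefl).
    case=> d' [rd cd]; have -> : d' = d by apply: cell_inj; rewrite ?rd ?cd.
    by lia.
  have := F_rows re; rewrite -ce ltnSn => /(_ isT).
  have le_ce := F_mono le_T; case: ifP => [lt_k | _].
    by rewrite (leq_ltn_trans le_ce lt_k) in k_le.
  by rewrite -eq_F ltnNge le_ce.
(* The converse is formal: [T] is injective and [precedes] is a strict order. *)
apply/idP/idP => [|prec]; first exact: lt_prec.
rewrite ltnNge leq_eqVlt; apply/norP; split.
  apply/eqP => /val_inj/(bij_inj T_bij) eq_dc.
  by rewrite eq_dc precedes_irr in prec.
by apply/negP => /lt_prec/(precedes_trans prec); rewrite precedes_irr.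
Qed.

End Destandardization.

(** * From a hook tableau to its standardization *)

Section Standardization.

Variables (k l n : nat) (al : seq nat) (F : filling (k + l) al).
Variable T : filling n al.
Hypotheses (F_HCT : is_HCT F) (T_bij : bijective T).
Hypothesis TE : forall c d, (T c < T d) = precedes k F c d.

(** The leftmost column is strict on unprimed letters. Elsewhere, if [c] is below [d], the left
    neighbour [e] of [d] satisfies [F e <= F d = F c], and (a) would force [F d < F c]. *)
Let F_col_inj c d : F c < k -> F c = F d -> col_of c = col_of d -> c = d.
Proof.
case/and3P: F_HCT => /HCT_rowsP rows /HCT_first_columnP fcol /HCT_triplesP tri.
have noF c' d' : F c' < k -> F c' = F d' -> col_of c' = col_of d' ->
    row_of c' < row_of d' -> False.
  move=> {c d} lt_k eq_F eq_c lt_r; rename c' into c, d' into d.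
  case: (posnP (col_of c)) => [c0 | c_gt0].
    have := fcol c d c0; rewrite -eq_c -eq_F lt_k ltnn => /(_ c0 lt_r) //.
  have [|e re ce] := @left_cell _ d; first by rewrite -eq_c.
  have := rows e d re; rewrite -ce ltnSn -eq_F => /(_ isT) rows_e.
  have := tri c e; rewrite re ce eq_c lt_k => /(_ lt_r erefl) []; last first.
    move=> d' [rd cd]; have -> : d' = d by apply: cell_inj; rewrite ?rd ?cd.
    by rewrite eq_F ltnn.
  by case: ifP rows_e; lia.
move=> lt_k eq_F eq_c; apply: cell_inj; last by rewrite eq_c.
case: (ltngtP (row_of c) (row_of d)) => // lt_r.
  by case: (noF c d).
by case: (noF d c); rewrite // -eq_F.
Qed.

Lemma standardization_SHCT : is_SHCT T.
Proof.
case/and3P: F_HCT => /HCT_rowsP rows /HCT_first_columnP fcol /HCT_triplesP tri.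
apply/and4P; split; first exact: bij_each_used_once.
- apply/SHCT_rowsP => c d er lt_c; rewrite TE /precedes.
  by have := rows c d er lt_c; case: ifP => _; lia.
- apply/SHCT_first_columnP => c d c0 d0 lt_r; rewrite TE /precedes.
  by have := fcol c d c0 d0 lt_r; rewrite c0 d0; case: ifP => _ /=; lia.
apply/SHCT_triplesP => c d lt_r eq_c; rewrite TE => prec.
have := tri c d lt_r eq_c; case: ifP => lt_k {}tri.
  have [|e [re ce lt_F]] := tri.
    by move: prec; rewrite /precedes; case: ifP; lia.
  by exists e; split => //; rewrite TE /precedes lt_F.
(* Equal primed letters are read from right to left, so [d], lying left of [c], can precede it only
   if [F d < F c]. *)
have [|e [re ce le_F]] := tri.
  by move: prec; rewrite /precedes; repeat case: ifP => ?; lia.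
(* In case of a tie, [e] is above [c] in a column other than the leftmost, which is read top to
   bottom; so [e] still comes first. *)
exists e; split => //; rewrite TE /precedes re ce.
have -> : (col_of c == 0 :> nat) = false by rewrite eq_c.
by case: ifP; lia.
Qed.

(** Equal letters are read in the column order that admissibility demands. The only exception, two
    equal unprimed letters in one column, is excluded by [F_col_inj]. *)
Lemma standardization_admissible (a : {ffun 'I_n -> 'I_(k + l)}) :
  (forall c, F c = a (T c)) -> Qtilde_admissible (descent_set T) a.
Proof.
move=> FE; apply/(Qtilde_admissibleP _ T_bij); split=> c d; rewrite -!FE.
  rewrite leq_eqVlt => /orP[/eqP/val_inj/(bij_inj T_bij)-> // |].
  by rewrite TE /precedes; lia.
move=> eq_d eq_F; have: T c < T d by rewrite eq_d.
rewrite TE /precedes eq_F ltnn eqxx /=.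
case: ifP => [lt_k | _] /=; last by lia.
case/orP=> // /andP[/eqP/val_inj eq_c _].
have eq_cd : c = d by apply: F_col_inj; rewrite ?eq_F.
by move: eq_d; rewrite eq_cd; lia.
Qed.

End Standardization.

(** * The weight-preserving bijection *)

Local Open Scope ring_scope.

Theorem theorem4p2 (k l n : nat) (al : seq nat) (hal : is_composition n al) :
  HQ k l al = \sum_(T : filling n al | is_SHCT T) Qtilde k l (descent_set T).
Proof.
have card_n : #|cell al| = n by case/andP: hal => _ /eqP <-; exact: card_cell.
pose A := [set u : filling n al * {ffun 'I_n -> 'I_(k + l)} |
  is_SHCT u.1 && Qtilde_admissible (descent_set u.1) u.2].
pose h (u : filling n al * {ffun 'I_n -> 'I_(k + l)}) : filling (k + l) al :=
  [ffun c => u.2 (u.1 c)].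
have bijA u : u \in A -> bijective u.1.
  by rewrite inE => /andP[/and4P[/each_used_once_bij]].
have h_inj : {in A &, injective h}.
  move=> [T a] [T' a'] uA uA' eq_h.
  have eqT : T = T'.
    apply/ffunP/bij_same_order; [exact: bijA uA | exact: bijA uA' |] => c d.
    move: uA uA' eq_h; rewrite !inE /h /= => /andP[T1 a1] /andP[T2 a2] eq_h.
    by rewrite (destandardization_order T1 a1) (destandardization_order T2 a2) eq_h.
  (* Once the tableaux agree, surjectivity of [T] determines [a] at every position. *)
  congr (_, _) => //; apply/ffunP => p.
  have [g _ /= gK] := bijA _ uA.
  by move/ffunP/(_ (g p)): eq_h; rewrite !ffunE /= -eqT gK.
have h_im : h @: A = [set F | is_HCT F].
  apply/setP=> F; rewrite inE; apply/imsetP/idP => [[[T a]] | F_HCT].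
    by rewrite inE => /andP[T1 a1] ->; exact: destandardization_HCT.
  have [T T_bij TE] := standardization_exists k F card_n.
  (* The sequence [a] lists the letters of [F] in the order in which [T] reads the cells. *)
  have [g TK gK] := T_bij; pose a := [ffun p => F (g p)].
  have FE c : F c = a (T c) by rewrite ffunE TK.
  exists (T, a); last by apply/ffunP => c; rewrite ffunE.
  rewrite inE /= (standardization_SHCT F_HCT) //.
  exact: standardization_admissible FE.
rewrite /HQ (eq_bigr _ (fun F _ => HCT_weight F)).
rewrite (eq_bigl (mem (h @: A))) => [|F]; last by rewrite h_im !inE.
rewrite big_imset //= /Qtilde pair_big_dep /=.
apply: eq_big => [u | u uA]; first by rewrite inE.
have [g TK gK] := bijA u uA.
(* The product over positions becomes a product over cells through the bijection [u.1]. *)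
rewrite [RHS](reindex u.1) /=; last by exists g => ? _; rewrite ?TK ?gK.
by apply: eq_bigr => c _; rewrite ffunE.
Qed.
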